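(* Let $K$ be an algebraically closed field and let $G$ be a finite, connected, undirected graph without loops or multiple edges. If the toric ideal $I_G$ associated to $G$ is generated by quadratic binomials, then (1) ${\rm bar}(I_G)=\mu(I_G)$, and (2) ${\rm ara}_G(I_G)=\mu(I_G)$.
   Context: Let $G$ have vertex set $V(G)=\{v_1,\ldots,v_n\}$ and edge set $E(G)=\{e_1,\ldots,e_m\}$. For $1\le i\le m$ let ${\bf a}_i=(a_{1,i},\ldots,a_{n,i})\in\mathbb{Z}^n$, where $a_{j,i}=1$ if $v_j$ is one of the two vertices of $e_i$ and $a_{j,i}=0$ otherwise. The toric ideal $I_G\subset K[x_1,\ldots,x_m]$ is the kernel of the $K$-algebra homomorphism $\phi:K[x_1,\ldots,x_m]\to K[t_1,\ldots,t_n]$ with $\phi(x_i)=t_1^{a_{1,i}}\cdots t_n^{a_{n,i}}$ (so $\phi(x_i)=t_kt_l$ if $e_i=\{v_k,v_l\}$). It is a prime ideal. The $G$-degree of a monomial ${\bf x}^{\bf u}=x_1^{u_1}\cdots x_m^{u_m}$ is $\deg_G({\bf x}^{\bf u})=u_1{\bf a}_1+\cdots+u_m{\bf a}_m$. A polynomial is $G$-homogeneous if all monomials in its nonzero terms have the same $G$-degree. A binomial is a difference of two monomials ${\bf x}^{\bf u}-{\bf x}^{\bf v}$; it is quadratic if both monomials have (usual) degree $2$. Let $rad(\cdot)$ denote the radical of the ideal generated by the listed polynomials. The binomial arithmetical rank ${\rm bar}(I_G)$ is the smallest integer $s$ for which there exist binomials $F_1,\ldots,F_s\in I_G$ with $I_G=rad(F_1,\ldots,F_s)$.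 The $G$-homogeneous arithmetical rank ${\rm ara}_G(I_G)$ is the smallest integer $s$ for which there exist $G$-homogeneous polynomials $F_1,\ldots,F_s\in I_G$ with $I_G=rad(F_1,\ldots,F_s)$. $\mu(I_G)$ denotes the minimal number of generators of $I_G$. *)

(* Defs.v *)
From HB Require Import structures.
From mathcomp Require Import all_boot all_order all_algebra.
From mathcomp Require Import mpoly.

Set Implicit Arguments.
Unset Strict Implicit.
Unset Printing Implicit Defensive.

Import GRing.Theory.

Local Open Scope ring_scope.

(** Finite simple graphs with labelled vertices and labelled edges: injectivity
    excludes multiple edges, [edge_card2] excludes loops. *)
Record sgraph (n m : nat) := SGraph {
  edge :> 'I_m -> {set 'I_n};
  edge_inj : injective edge;
  edge_card2 : forall i, #|edge i| = 2
}.

Definition adj n m (G : sgraph n m) : rel 'I_n :=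
  fun x y => [exists i, G i == [set x; y]].

Definition connected n m (G : sgraph n m) : Prop :=
  (0 < n)%N /\ forall x y : 'I_n, connect (adj G) x y.

Section Ideals.
Variables (R : comNzRingType).

Definition ideal_gen (S : R -> Prop) (p : R) : Prop :=
  exists (k : nat) (c f : 'I_k -> R),
    (forall i, S (f i)) /\ p = \sum_(i < k) c i * f i.

Definition radical (J : R -> Prop) (p : R) : Prop :=
  exists k : nat, (0 < k)%N /\ J (p ^+ k).

Definition list_ideal (F : seq R) : R -> Prop := ideal_gen (fun f => f \in F).

Definition same_set (I J : R -> Prop) : Prop := forall p, I p <-> J p.

(** [is_min P s]: [s] is the smallest natural number satisfying [P]; in
    particular such a number exists. *)
Definition is_min (P : nat -> Prop) (s : nat) : Prop :=
  P s /\ forall t, P t -> (s <= t)%N.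

Definition is_mu (I : R -> Prop) : nat -> Prop :=
  is_min (fun s => exists F : s.-tuple R, same_set I (list_ideal F)).

(** The smallest number of elements of [I], all satisfying [Q], that generate
    [I] up to radical. *)
Definition is_arith_rank (Q : R -> Prop) (I : R -> Prop) : nat -> Prop :=
  is_min (fun s => exists F : s.-tuple R,
    [/\ forall f, f \in F -> Q f,
        forall f, f \in F -> I f
      & same_set I (radical (list_ideal F))]).

End Ideals.

Section Toric.
Variables (K : fieldType) (n m : nat) (G : sgraph n m).

(** Incidence vector of the [i]-th edge, as an exponent vector in N^n rather
    than Z^n: its entries are 0 or 1. *)
Definition edge_vec (i : 'I_m) : 'X_{1..n} :=
  [multinom nat_of_bool (j \in G i) | j < n].

Definition phi (p : {mpoly K[m]}) : {mpoly K[n]} :=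
  p \mPo [tuple 'X_[K, edge_vec i] | i < m].

Definition toric_ideal (p : {mpoly K[m]}) : Prop := phi p = 0.

Definition deg_G (u : 'X_{1..m}) : 'X_{1..n} :=
  (\sum_(i < m) edge_vec i *+ u i)%MM.

Definition G_homogeneous (p : {mpoly K[m]}) : Prop :=
  {in msupp p &, forall u v, deg_G u = deg_G v}.

Definition is_binomial (p : {mpoly K[m]}) : Prop :=
  exists u v : 'X_{1..m}, p = 'X_[u] - 'X_[v].

Definition is_quadratic_binomial (p : {mpoly K[m]}) : Prop :=
  exists u v : 'X_{1..m}, [/\ mdeg u = 2, mdeg v = 2 & p = 'X_[u] - 'X_[v]].

Definition generated_by_quadratic_binomials (I : {mpoly K[m]} -> Prop) : Prop :=
  exists S : {mpoly K[m]} -> Prop,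
    (forall f, S f -> is_quadratic_binomial f) /\ same_set I (ideal_gen S).

Definition is_bar (I : {mpoly K[m]} -> Prop) : nat -> Prop :=
  is_arith_rank is_binomial I.

Definition is_ara_G (I : {mpoly K[m]} -> Prop) : nat -> Prop :=
  is_arith_rank G_homogeneous I.

End Toric.

Arguments toric_ideal K {n m} G p.

(* Main.v *)
(* A nontrivial relation between quadratic monomials lives on a set S of exactly
   four vertices: monomials supported on at most three vertices are determined
   by their G-degree.  The fibre over S consists of the perfect matchings of S,
   at most three of them.  Keeping one representative per fibre, the binomials
   "monomial minus representative" generate I_G, and their number r is mu(I_G)
   because the degree-2 coefficients at the non-representatives are independent.

   For the lower bound on the G-homogeneous arithmetical rank, restrict to
   points vanishing outside the edges inside S.  There every G-homogeneous
   element of I_G vanishes unless the support of its degree is exactly S, so each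
   S needs its own F_i's: at least one if there are two matchings, and two if
   there are three, since one weighted-homogeneous equation always has a zero on
   a plane where the relations only vanish at the origin.  Binomials of I_G are
   G-homogeneous, so the same bound holds for bar(I_G). *)
Require Import Defs.
From mathcomp Require Import all_boot all_order all_algebra zify ring.
From mathcomp Require Import mpoly.

Set Implicit Arguments.
Unset Strict Implicit.
Unset Printing Implicit Defensive.

Import GRing.Theory.

(** * Fibres of the G-degree on monomials *)

Section Fibers.
Variables (n m : nat) (G : sgraph n m).
Implicit Types (u v w : 'X_{1..m}) (d : 'X_{1..n}) (e : 'I_m) (x : 'I_n).

Definition vsupp d : {set 'I_n} := [set x | 0 < d x].

(* [edge_card2] is parsed in [ring_scope], where its right-hand side is
   [2%:R : nat]. *)
Lemma card_edge e : #|G e| = 2.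
Proof. exact: edge_card2. Qed.

Lemma deg_GE u x : deg_G G u x = \sum_e (x \in G e) * u e.
Proof.
by rewrite /deg_G mnm_sumE; apply: eq_bigr => e _; rewrite mulmnE mnmE.
Qed.

Lemma deg_G_add u v : deg_G G (u + v)%MM = (deg_G G u + deg_G G v)%MM.
Proof.
apply/mnmP => x; rewrite mnmDE !deg_GE -big_split /=.
by apply: eq_bigr => e _; rewrite mnmDE mulnDr.
Qed.

Lemma sum_deg_G u (A : {set 'I_n}) :
  \sum_(x in A) deg_G G u x = \sum_e u e * #|A :&: G e|.
Proof.
under eq_bigr do rewrite deg_GE.
rewrite exchange_big /=; apply: eq_bigr => e _.
rewrite -big_distrl /= mulnC; congr (_ * _).
rewrite -sum1_card big_mkcond [RHS]big_mkcond /=.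
by apply: eq_bigr => x _; rewrite inE; do 2!case: (_ \in _).
Qed.

Lemma mdeg_deg_G u : mdeg (deg_G G u) = mdeg u * 2.
Proof.
rewrite !mdegE big_distrl /=.
transitivity (\sum_(x in [set: 'I_n]) deg_G G u x).
  by apply: eq_bigl => x; rewrite inE.
by rewrite sum_deg_G; apply: eq_bigr => e _; rewrite setTI card_edge.
Qed.

Lemma edge_sub_vsupp u e : 0 < u e -> G e \subset vsupp (deg_G G u).
Proof.
move=> ue; apply/subsetP => x xe; rewrite inE deg_GE (bigD1 e) //= xe mul1n.
exact: leq_trans ue (leq_addr _ _).
Qed.

Lemma edge_at_vertex u x : 0 < deg_G G u x -> exists2 e, x \in G e & 0 < u e.
Proof.
rewrite deg_GE lt0n sum_nat_eq0 negb_forall => /existsP[e].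
by rewrite /= muln_eq0 negb_or eqb0 negbK -lt0n => /andP[xe ue]; exists e.
Qed.

(* Two edges inside a set of at most three vertices meet, so an edge [f] has
   at least as many ends in [e] as outside, with equality iff [f != e]. *)
Lemma edge_mult_small u e :
  #|vsupp (deg_G G u)| <= 3 -> G e \subset vsupp (deg_G G u) ->
  \sum_(x in G e) deg_G G u x = \sum_(x in ~: G e) deg_G G u x + (u e).*2.
Proof.
move=> S3 eS; rewrite !sum_deg_G.
rewrite (bigD1 e) //= [in RHS](bigD1 e) //= setIid.
rewrite (setIC (~: _)) setICr card_edge cards0 muln0 add0n muln2 addnC.
congr (_ + _); apply: eq_bigr => f fe.
have [->|] := posnP (u f); first by rewrite !mul0n.
move=> /edge_sub_vsupp fS; congr (_ * _).
have H1 := cardsID (G e) (G f); rewrite card_edge in H1.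
have H2 := cardsUI (G e) (G f); rewrite !card_edge in H2.
have H3 : #|G e :|: G f| <= 3.
  by apply: leq_trans S3; apply: subset_leq_card; rewrite subUset eS.
have H4 : #|G e :&: G f| <> 2.
  move=> H; case/negP: fe; apply/eqP; apply: (@edge_inj _ _ G).
  have Ee : G e :&: G f = G e.
    by apply/eqP; rewrite eqEcard subsetIl card_edge H.
  have Ef : G e :&: G f = G f.
    by apply/eqP; rewrite eqEcard subsetIr card_edge H.
  by rewrite -Ef Ee.
rewrite setDE ![G f :&: _]setIC in H1.
have H5 : #|G e :&: G f| = 1 by lia.
by move: H1; rewrite H5 add1n => -[->].
Qed.

(** The identity of [edge_mult_small] recovers [u e] from the degree for edges inside the support;
    all other exponents vanish. *)
Lemma deg_G_inj_small u v :
  #|vsupp (deg_G G u)| <= 3 -> deg_G G u = deg_G G v -> u = v.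
Proof.
move=> S3 uv; apply/mnmP => e.
have [eS|neS] := boolP (G e \subset vsupp (deg_G G u)).
  have Hu := edge_mult_small S3 eS.
  move: S3 eS Hu; rewrite uv => S3 eS; rewrite (edge_mult_small S3 eS).
  by move/addnI/double_inj.
have u0 : u e = 0.
  by apply/eqP; rewrite -leqn0 leqNgt; apply: contra neS => /edge_sub_vsupp.
rewrite u0; apply/esym/eqP; rewrite -leqn0 leqNgt.
by apply: contra neS => /edge_sub_vsupp; rewrite uv.
Qed.

Lemma card_vsupp_mdeg d : #|vsupp d| <= mdeg d.
Proof.
rewrite mdegE -sum1_card big_mkcond leq_sum // => x _.
by rewrite inE; case: (d x).
Qed.

Lemma deg_G_inj_mdeg1 u v : mdeg u <= 1 -> deg_G G u = deg_G G v -> u = v.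
Proof.
move=> u1; apply: deg_G_inj_small.
by rewrite (leq_trans (card_vsupp_mdeg _)) // mdeg_deg_G; lia.
Qed.

Lemma mnm_splitU u e : 0 < u e -> u = (U_(e) + (u - U_(e)))%MM.
Proof.
move=> ue; rewrite addmC submK //; apply/mnm_lepP => f.
by rewrite mnm1E; case: eqP => // <-.
Qed.

Section QuadFiber.
Variables u v : 'X_{1..m}.
Hypotheses (mu : mdeg u = 2) (uv : deg_G G u = deg_G G v) (nuv : u <> v).

Lemma card_quad_vsupp : #|vsupp (deg_G G u)| = 4.
Proof.
apply/eqP; rewrite eqn_leq; apply/andP; split.
  by rewrite (leq_trans (card_vsupp_mdeg _)) // mdeg_deg_G mu.
by rewrite ltnNge; apply/negP => /deg_G_inj_small - /(_ _ uv).
Qed.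

(** Total degree four on four vertices leaves one per vertex, so [u] is a perfect matching. *)
Lemma quad_deg_G x : deg_G G u x = (x \in vsupp (deg_G G u)).
Proof.
rewrite inE; set d := deg_G G u.
have le1 y : (0 < d y) <= d y by case: (d y).
have E : \sum_y (d y - (0 < d y)) = 0.
  rewrite sumnB // -mdegE /d mdeg_deg_G mu; apply/eqP; rewrite subn_eq0.
  rewrite -[leqLHS]card_quad_vsupp -sum1_card big_mkcond /=.
  by apply: leq_sum => y _; rewrite inE; case: (_ < _).
move/eqP: E; rewrite sum_nat_eq0 => /forallP/(_ x)/=; have := le1 x; lia.
Qed.

(** Cancelling a common edge would leave monomials of degree one with the same G-degree, hence
    equal. *)
Lemma quad_disjoint e : 0 < u e -> v e = 0.
Proof.
move=> ue; apply/eqP; rewrite -leqn0 leqNgt; apply/negP => ve; apply: nuv.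
rewrite (mnm_splitU ue) (mnm_splitU ve); congr (_ + _)%MM.
apply: deg_G_inj_mdeg1.
  by have := mu; rewrite {1}(mnm_splitU ue) mdegD mdeg1; lia.
by move: uv; rewrite {1}(mnm_splitU ue) {1}(mnm_splitU ve) !deg_G_add => /addmI.
Qed.

End QuadFiber.
End Fibers.

Local Open Scope ring_scope.

(** * Generated ideals *)

Section IdealGen.
Variable R : comNzRingType.
Implicit Types (S J : R -> Prop) (p q : R).

Lemma ideal_gen_sub S J :
    J 0 -> (forall p q, J p -> J q -> J (p + q)) ->
    (forall c p, J p -> J (c * p)) -> (forall p, S p -> J p) ->
  forall p, ideal_gen S p -> J p.
Proof.
move=> J0 JD JM SJ _ [k [c [f [Sf ->]]]].
by apply: big_ind => // i _; apply/JM/SJ.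
Qed.

Lemma ideal_gen_incl S p : S p -> ideal_gen S p.
Proof.
by exists 1%N, (fun=> 1), (fun=> p); rewrite big_ord1 mul1r.
Qed.

Lemma ideal_gen0 S : ideal_gen S 0.
Proof.
by exists 0%N, (fun=> 0), (fun=> 0); rewrite big_ord0; split=> // -[].
Qed.

Lemma ideal_genM S c p : ideal_gen S p -> ideal_gen S (c * p).
Proof.
move=> [k [a [f [Sf ->]]]]; exists k, (fun i => c * a i), f; split=> //.
by rewrite big_distrr; apply: eq_bigr => i _ /=; rewrite mulrA.
Qed.

Lemma ideal_genD S p q : ideal_gen S p -> ideal_gen S q -> ideal_gen S (p + q).
Proof.
move=> [k [a [f [Sf ->]]]] [l [b [g [Sg ->]]]].
pose pick T (x : 'I_k -> T) (y : 'I_l -> T) i :=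
  match split i with inl i => x i | inr i => y i end.
exists (k + l)%N, (pick R a b), (pick R f g); split=> [i|].
  by rewrite /pick; case: (split i).
rewrite big_split_ord /=; congr (_ + _); apply: eq_bigr => i _; rewrite /pick.
  by rewrite (unsplitK (inl i)).
by rewrite (unsplitK (inr i)).
Qed.

(** [ideal_gen] allows repeated generators; collecting them leaves one coefficient per entry, as the
    matrix argument for mu needs. *)
Lemma list_ideal_tupleP s (F : s.-tuple R) p :
  list_ideal F p -> exists c : 'I_s -> R, p = \sum_i c i * tnth F i.
Proof.
apply: (@ideal_gen_sub _ (fun p => exists c, p = \sum_i c i * tnth F i)).
- by exists (fun=> 0); rewrite big1 // => i _; rewrite mul0r.
- move=> _ _ [c ->] [d ->]; exists (fun i => c i + d i).
  by rewrite -big_split; apply: eq_bigr => i _ /=; rewrite mulrDl.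
- move=> a _ [c ->]; exists (fun i => a * c i).
  by rewrite big_distrr; apply: eq_bigr => i _ /=; rewrite mulrA.
- move=> _ /tnthP[i ->]; exists (fun j => (j == i)%:R).
  rewrite (bigD1 i) //= eqxx mul1r big1 ?addr0 // => j /negPf ->.
  by rewrite mul0r.
Qed.

End IdealGen.

(** * Lowest-degree coefficients and zeros of weighted-homogeneous polynomials *)

Lemma mcoeffM_low (R : comNzRingType) m (c F : {mpoly R[m]}) (w : 'X_{1..m}) :
  (forall v, (mdeg v < mdeg w)%N -> F@_v = 0) -> (c * F)@_w = c@_0 * F@_w.
Proof.
move=> F0; rewrite mcoeffM.
pose k0 : 'X_{1..m < (mdeg w).+1, (mdeg w).+1} :=
  (bm0, BMultinom (ltnSn (mdeg w))).
rewrite (bigD1 k0) /=; last by rewrite add0m.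
rewrite big1 ?addr0 // => -[k1 k2] /= /andP[/eqP wk nk].
have [/F0 ->|] := ltnP (mdeg k2) (mdeg w); first by rewrite mulr0.
rewrite {1}wk mdegD -{2}[mdeg k2]add0n leq_add2r leqn0 mdeg_eq0 => /eqP k10.
move: wk nk; rewrite k10 add0m => wk /eqP[]; rewrite /k0; congr (_, _).
  by apply/val_inj.
exact/val_inj.
Qed.

Lemma prod_monomial_curve (R : comNzRingType) m (a b : 'I_m -> nat)
    (p : 'I_m -> R) (s t : R) (u : 'X_{1..m}) :
  \prod_e (p e * s ^+ a e * t ^+ b e) ^+ u e =
  (\prod_e p e ^+ u e) * s ^+ (\sum_e a e * u e)%N * t ^+ (\sum_e b e * u e)%N.
Proof.
rewrite !expr_sum -!big_split; apply: eq_bigr => e _ /=.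
by rewrite !exprMn -!exprM.
Qed.

(** Pulled back to the variables [s] and [t], [F] is a form of degree [d > 0], which has a zero on
    the projective line. *)
Lemma whomog_nontrivial_zero (K : closedFieldType) m (F : {mpoly K[m]})
    (a b : 'I_m -> nat) (p : 'I_m -> K) (d : nat) :
    (0 < d)%N ->
    {in msupp F, forall u : 'X_{1..m}, \sum_e (a e + b e) * u e = d}%N ->
  exists s t : K, (s != 0) || (t != 0) /\
    F.@[fun e => p e * s ^+ a e * t ^+ b e] = 0.
Proof.
move=> d0 Fd.
pose A (u : 'X_{1..m}) := (\sum_e a e * u e)%N.
pose B (u : 'X_{1..m}) := (\sum_e b e * u e)%N.
pose c (u : 'X_{1..m}) := \prod_e p e ^+ u e.
have AB u : u \in msupp F -> (A u + B u)%N = d.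
  move=> /Fd <-; rewrite -big_split; apply: eq_bigr => e _.
  by rewrite /= mulnDl.
have evalE s t : F.@[fun e => p e * s ^+ a e * t ^+ b e] =
    \sum_(u <- msupp F) F@_u * c u * s ^+ A u * t ^+ B u.
  rewrite mevalE; apply: eq_bigr => u _.
  by rewrite prod_monomial_curve !mulrA.
(* [q] is [F] on the line [t = 1], and its coefficient of degree [d] is the value
   of [F] at [(s, t) = (1, 0)]: if that is nonzero, [q] has a root. *)
pose q := \sum_(u <- msupp F) (F@_u * c u)%:P * 'X^(A u).
have q1 s : q.[s] = F.@[fun e => p e * s ^+ a e * 1 ^+ b e].
  rewrite evalE horner_sum; apply: eq_bigr => u _.
  by rewrite !hornerE expr1n mulr1.
have qd : q`_d = F.@[fun e => p e * 1 ^+ a e * 0 ^+ b e].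
  rewrite evalE coef_sum; apply: eq_big_seq => u /AB <-.
  rewrite coefCM coefXn expr1n mulr1 expr0n; congr (_ * _%:R).
  by rewrite -{2}[A u]addn0 eqn_add2l.
have [s1|/closed_rootP[s /rootP qs]] := eqVneq (size q) 1%N; last first.
  by exists s, 1; rewrite oner_eq0 orbT -q1.
by exists 1, 0; rewrite oner_eq0 -qd nth_default // s1.
Qed.

(** * Coefficients and zeros of elements of the toric ideal *)

Section Toric.
Variables (K : fieldType) (n m : nat) (G : sgraph n m).
Implicit Types (F p : {mpoly K[m]}) (u v w : 'X_{1..m}) (S : {set 'I_n}).
Implicit Types (P : 'I_m -> K) (e : 'I_m) (x : 'I_n).

Lemma phiX u : phi G 'X_[K, u] = 'X_[deg_G G u].
Proof.
rewrite /phi comp_mpolyX /deg_G.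
rewrite (big_morph _ (@mpolyXD _ _) (@mpolyX0 _ _)); apply: eq_bigr => e _.
by rewrite tnth_mktuple mpolyXn.
Qed.

Lemma phiE p : phi G p = \sum_(u <- msupp p) p@_u *: 'X_[deg_G G u].
Proof.
by rewrite {1}/phi comp_mpolyEX; apply: eq_bigr => u _; rewrite -phiX.
Qed.

(** The coefficient of [phi G p] at [deg_G G u] is the sum of those of [p] over the fibre of [u],
    here a single one. *)
Lemma toric_mcoeff0 p u :
  toric_ideal K G p -> (forall v, deg_G G v = deg_G G u -> v = u) -> p@_u = 0.
Proof.
move=> /(congr1 (mcoeff (deg_G G u))) Ip fib; apply/eqP.
rewrite mcoeff_eq0; apply/negP => pu; move/eqP: Ip.
rewrite phiE mcoeff0 raddf_sum (bigD1_seq u) ?msupp_uniq //=.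
rewrite mcoeffZ mcoeffX eqxx mulr1 big1 ?addr0; last first.
  move=> v; rewrite mcoeffZ mcoeffX => vu.
  by case: eqP => [/fib vE|_]; rewrite ?mulr0 //; rewrite vE eqxx in vu.
by rewrite mcoeff_eq0 pu.
Qed.

Lemma toric_mcoeff_low p u :
  toric_ideal K G p -> (mdeg u <= 1)%N -> p@_u = 0.
Proof.
by move=> Ip u1; apply: toric_mcoeff0 Ip _ => v /esym/(deg_G_inj_mdeg1 u1).
Qed.

Lemma toric_binomialP u v :
  toric_ideal K G ('X_[K, u] - 'X_[v]) <-> deg_G G u = deg_G G v.
Proof.
have -> : toric_ideal K G ('X_[u] - 'X_[v]) =
    (phi G 'X_[K, u] - phi G 'X_[v] = 0).
  by rewrite /toric_ideal /phi raddfB.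
rewrite !phiX.
split=> [/eqP|->]; last by rewrite subrr.
rewrite subr_eq0 => /eqP/(congr1 (mcoeff (deg_G G u))).
rewrite !mcoeffX eqxx eq_sym; case: eqP => // _ /eqP.
by rewrite oner_eq0.
Qed.

Lemma toric_ideal0 : toric_ideal K G (0 : {mpoly K[m]}).
Proof. exact: comp_mpoly0. Qed.

Lemma toric_idealD p q :
  toric_ideal K G p -> toric_ideal K G q -> toric_ideal K G (p + q).
Proof. by rewrite /toric_ideal /phi raddfD /= => -> ->; rewrite addr0. Qed.

Lemma toric_idealM c p : toric_ideal K G p -> toric_ideal K G (c * p).
Proof. by rewrite /toric_ideal /phi rmorphM /= => ->; rewrite mulr0. Qed.

Lemma toric_ideal_gen (T : {mpoly K[m]} -> Prop) p :
  (forall f, T f -> toric_ideal K G f) -> ideal_gen T p -> toric_ideal K G p.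
Proof.
move=> TI; apply: ideal_gen_sub; [exact: toric_ideal0 | exact: toric_idealD
  | exact: toric_idealM | exact: TI].
Qed.

Lemma toric_radical p : radical (toric_ideal K G) p -> toric_ideal K G p.
Proof.
move=> [k [_]]; rewrite /toric_ideal /phi rmorphXn /= => /eqP.
by rewrite expf_eq0 => /andP[_ /eqP].
Qed.

Lemma toric_binomial_homogeneous p :
  is_binomial p -> toric_ideal K G p -> G_homogeneous G p.
Proof.
move=> [u [v ->]] /toric_binomialP uv.
suff H w : w \in msupp ('X_[K, u] - 'X_[v]) -> deg_G G w = deg_G G u.
  by move=> w w' /H -> /H ->.
rewrite mcoeff_msupp mcoeffB !mcoeffX.
case: (u =P w) => [->//|_]; case: (v =P w) => [<-//|_].
by rewrite subrr eqxx.
Qed.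

(* Every monomial of a [G]-homogeneous [p] has the [G]-degree of [mlead p]; for
   [p = 0] the junk value [mlead 0 = 0] gives the empty set. *)
Definition gsupp p : {set 'I_n} := vsupp (deg_G G (mlead p)).

(** If the support of the degree of [F] lies properly in [S], it has at most three vertices, so
    [mlead F] is alone in its fibre and [F] is zero. Otherwise every monomial of [F] uses an edge
    leaving [S], where [P] is zero. *)
Lemma meval_off_gsupp F S P :
    G_homogeneous G F -> toric_ideal K G F ->
    (forall e, P e != 0 -> G e \subset S) -> (#|S| <= 4)%N -> gsupp F != S ->
  F.@[P] = 0.
Proof.
move=> homF IF PS S4 FS.
have [->|F0] := eqVneq F 0; first by rewrite meval0.
have [sub|/subsetPn[x xF xS]] := boolP (gsupp F \subset S).
  have : (#|gsupp F| < #|S|)%N.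
    by rewrite proper_card // properEneq FS.
  move=> /leq_trans/(_ S4); rewrite ltnS => small.
  move: F0; rewrite -mleadc_eq0 (toric_mcoeff0 IF) ?eqxx // => v /esym.
  by move/(deg_G_inj_small small).
rewrite mevalE big1_seq // => u /andP[_ uF].
move: xF; rewrite inE -(homF _ _ uF (mlead_supp F0)).
move=> /edge_at_vertex[e xe ue].
have /eqP Pe : P e == 0.
  by apply/negPn/negP => /PS/subsetP/(_ _ xe); apply/negP.
by rewrite (bigD1 e) //= Pe expr0n (gtn_eqF ue) mul0r mulr0.
Qed.

Lemma meval_radical (L : seq {mpoly K[m]}) P p :
  (forall f, f \in L -> f.@[P] = 0) -> radical (list_ideal L) p -> p.@[P] = 0.
Proof.
move=> L0 [k [k0 Jp]].
have : (p ^+ k).@[P] = 0.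
  apply: (@ideal_gen_sub _ _ (fun q => q.@[P] = 0)) Jp => //.
  - exact: meval0.
  - by move=> f g; rewrite mevalD => -> ->; rewrite addr0.
  - by move=> c f; rewrite mevalM => ->; rewrite mulr0.
by rewrite rmorphXn => /eqP; rewrite expf_eq0 => /andP[_ /eqP].
Qed.

(** * Fibre representatives and the value of mu *)

(* The representative depends on the [G]-degree only, so monomials of the same
   [G]-degree share it; [bm0] is a junk value, for degrees of no quadratic monomial. *)
Definition fiber_rep (d : 'X_{1..n}) : 'X_{1..m < 3} :=
  odflt bm0 [pick v : 'X_{1..m < 3} | (mdeg v == 2) && (deg_G G v == d)].

Definition nonreps : {set 'X_{1..m < 3}} :=
  [set u : 'X_{1..m < 3} | (mdeg u == 2) && (fiber_rep (deg_G G u) != u)].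

Definition rep_binomial u : {mpoly K[m]} :=
  'X_[u] - 'X_[fiber_rep (deg_G G u)].

Lemma fiber_repP u : mdeg u = 2 ->
  mdeg (fiber_rep (deg_G G u)) = 2 /\
  deg_G G (fiber_rep (deg_G G u)) = deg_G G u.
Proof.
move=> u2; rewrite /fiber_rep; case: pickP => [v /andP[/eqP ? /eqP ?] //|].
have u3 : (mdeg u < 3)%N by rewrite u2.
by move/(_ (BMultinom u3)); rewrite /= u2 !eqxx.
Qed.

Lemma nonrepsP (u : 'X_{1..m < 3}) : u \in nonreps ->
  [/\ mdeg u = 2, deg_G G (fiber_rep (deg_G G u)) = deg_G G u
    & fiber_rep (deg_G G u) <> u :> 'X_{1..m}].
Proof.
rewrite inE => /andP[/eqP u2 /eqP nu].
by have [_ ud] := fiber_repP u2; split=> // /val_inj.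
Qed.

Lemma toric_rep_binomial (u : 'X_{1..m < 3}) :
  u \in nonreps -> toric_ideal K G (rep_binomial u).
Proof. by move=> /nonrepsP[_ ud _]; apply/toric_binomialP. Qed.

(** A representative represents itself, so it differs from every [w] in [nonreps]. *)
Lemma mcoeff_rep_binomial (u w : 'X_{1..m < 3}) :
  u \in nonreps -> w \in nonreps -> (rep_binomial u)@_w = (u == w)%:R.
Proof.
move=> /nonrepsP[_ ud _] /nonrepsP[_ _ wn].
have /eqP/negPf nuw : bmnm (fiber_rep (deg_G G u)) <> w.
  by move=> uw; case: wn; rewrite -{1}uw ud uw.
by rewrite mcoeffB !mcoeffX nuw subr0.
Qed.

Lemma binomial_rep_binomial u v :
  deg_G G u = deg_G G v -> 'X_[u] - 'X_[v] = rep_binomial u - rep_binomial v.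
Proof. by move=> uv; rewrite /rep_binomial uv; ring. Qed.

Definition nonrep_binomials : #|nonreps|.-tuple {mpoly K[m]} :=
  [tuple rep_binomial (enum_val i) | i < #|nonreps|].

Lemma nonrep_binomialsP f :
  f \in nonrep_binomials -> exists2 u, u \in nonreps & f = rep_binomial u.
Proof.
move=> /tnthP[i ->]; rewrite tnth_mktuple.
by exists (enum_val i); first exact: enum_valP.
Qed.

Lemma rep_binomial_in (u : 'X_{1..m < 3}) :
  u \in nonreps -> rep_binomial u \in nonrep_binomials.
Proof.
move=> uW; apply/tnthP; exists (enum_rank_in uW u).
by rewrite tnth_mktuple enum_rankK_in.
Qed.

Lemma list_ideal_rep_binomial u :
  mdeg u = 2 -> list_ideal nonrep_binomials (rep_binomial u).
Proof.
move=> u2; have u3 : (mdeg u < 3)%N by rewrite u2.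
have [uW|] := boolP (BMultinom u3 \in nonreps).
  by apply: ideal_gen_incl; exact: (rep_binomial_in uW).
rewrite inE /= u2 eqxx /= negbK /rep_binomial => /eqP ->.
by rewrite subrr; exact: ideal_gen0.
Qed.

Lemma nonrep_binomials_gen :
  generated_by_quadratic_binomials (toric_ideal K G) ->
  same_set (toric_ideal K G) (list_ideal nonrep_binomials).
Proof.
move=> [T [Tq TI]] p; split=> [/TI|].
  apply: ideal_gen_sub; [exact: ideal_gen0 | exact: ideal_genD
    | exact: ideal_genM | move=> f Tf].
  have If : toric_ideal K G f by apply/TI/ideal_gen_incl.
  have [u [v [u2 v2 fE]]] := Tq f Tf.
  move: If; rewrite fE => /toric_binomialP/binomial_rep_binomial ->.
  rewrite -mulN1r; apply: ideal_genD; last apply: ideal_genM.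
    exact: list_ideal_rep_binomial.
  exact: list_ideal_rep_binomial.
apply: toric_ideal_gen => f /nonrep_binomialsP[u uW ->].
exact: toric_rep_binomial.
Qed.

(** The row space of [M], which has only [s] rows, contains the degree-two coefficient vectors of
    the [rep_binomial]s, and these form an identity matrix. *)
Lemma leq_card_nonreps_gen s (F : s.-tuple {mpoly K[m]}) :
  same_set (toric_ideal K G) (list_ideal F) -> (#|nonreps| <= s)%N.
Proof.
move=> IF.
pose M := \matrix_(i < s, j < #|nonreps|)
  (tnth F i)@_(enum_val j : 'X_{1..m < 3}).
have sub : (1%:M <= M)%MS.
  apply/row_subP => i; have uW := enum_valP i.
  have /IF/list_ideal_tupleP[c cE] := toric_rep_binomial uW.
  (* Constant terms suffice: elements of the ideal have no terms of degree below two. *)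
  apply/submxP; exists (\row_k (c k)@_0); apply/rowP => j.
  rewrite !mxE; have -> : (i == j) = (enum_val i == enum_val j).
    by rewrite (inj_eq enum_val_inj).
  have wW := enum_valP j; have [w2 _ _] := nonrepsP wW.
  rewrite -mcoeff_rep_binomial // cE raddf_sum; apply: eq_bigr => k _.
  rewrite !mxE /= mcoeffM_low // => v; rewrite w2 ltnS => v1.
  apply: toric_mcoeff_low v1; apply/IF/ideal_gen_incl; exact: mem_tnth.
by have := mxrankS sub; rewrite mxrank1 => /leq_trans->//; exact: rank_leq_row.
Qed.

End Toric.

(** * Lower bounds, one vertex set at a time *)

Section LowerBound.
Variables (K : closedFieldType) (n m : nat) (G : sgraph n m).
Implicit Types (F : {mpoly K[m]}) (S : {set 'I_n}).
Implicit Types (P : 'I_m -> K) (e : 'I_m) (x : 'I_n).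

Definition nonreps_at S : {set 'X_{1..m < 3}} :=
  [set u in nonreps G | vsupp (deg_G G u) == S].

Lemma nonreps_atP S (u : 'X_{1..m < 3}) : u \in nonreps_at S ->
  [/\ u \in nonreps G, #|S| = 4 & forall x, deg_G G u x = (x \in S) :> nat].
Proof.
rewrite inE => /andP[uW /eqP uS]; have [u2 ud /nesym nu] := nonrepsP uW.
split=> // [|x]; first by rewrite -uS (card_quad_vsupp u2 (esym ud) nu).
by rewrite (quad_deg_G u2 (esym ud) nu) uS.
Qed.

Lemma nonreps_at_deg S (u v : 'X_{1..m < 3}) :
  u \in nonreps_at S -> v \in nonreps_at S -> deg_G G u = deg_G G v.
Proof.
move=> /nonreps_atP[_ _ ud] /nonreps_atP[_ _ vd].
by apply/mnmP => x; rewrite ud vd.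
Qed.

Lemma sub_edge_at S (u : 'X_{1..m < 3}) v e :
  u \in nonreps_at S -> deg_G G v = deg_G G u -> (0 < v e)%N -> G e \subset S.
Proof.
rewrite inE => /andP[_ /eqP <-] <-; exact: edge_sub_vsupp.
Qed.

(* The members of a fibre over [S] are disjoint perfect matchings of [S], and a
   vertex of [S] has at most three possible partners; one of the at most three
   matchings is the representative. *)
Lemma card_nonreps_at S : (#|nonreps_at S| <= 2)%N.
Proof.
have [->|[u uS]] := set_0Vmem (nonreps_at S); first by rewrite cards0.
have [uW S4 ud] := nonreps_atP uS; have [u2 wd _] := nonrepsP uW.
pose w := fiber_rep G (deg_G G u).
have wT : w \notin nonreps_at S.
  by rewrite !inE wd eqxx andbF.
have Td v : v \in w |: nonreps_at S -> deg_G G v = deg_G G u /\ mdeg v = 2.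
  case/setU1P => [->|vS]; first by have [] := fiber_repP G u2.
  have [/nonrepsP[v2 _ _] _ _] := nonreps_atP vS.
  by rewrite (nonreps_at_deg vS uS).
have [a aS] : exists a, a \in S by apply/set0Pn; rewrite -card_gt0 S4.
pose partner (v : 'X_{1..m}) b :=
  [exists e, [&& (0 < v e)%N, a \in G e & b \in G e]].
(* The vertex matched with [a]; by [gP] the default [a] never occurs on the matchings considered. *)
pose g (v : 'X_{1..m < 3}) := odflt a [pick b in S :\ a | partner v b].
have gP v : v \in w |: nonreps_at S -> (g v \in S :\ a) && partner v (g v).
  move=> /Td[vd v2]; rewrite /g; case: pickP => [b //|no].
  have [|e ae ve] := @edge_at_vertex _ _ G v a; first by rewrite vd ud aS.
  have /eqP/cards1P[b bE] : #|G e :\ a| = 1%N.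
    by have := cardsD1 a (G e); rewrite card_edge ae add1n => -[].
  have : b \in G e :\ a by rewrite bE set11.
  rewrite 2!inE => /andP[ba be]; have := no b; rewrite !inE ba /=.
  rewrite (subsetP (sub_edge_at uS vd ve)) //=.
  by move=> /negbT/existsP[]; exists e; rewrite ve ae be.
have g_inj : {in w |: nonreps_at S &, injective g}.
  move=> v v' vT vT' gE; apply/val_inj/eqP; apply/negPn/negP => /eqP nv.
  have [vd v2] := Td _ vT; have [vd' v2'] := Td _ vT'.
  have /andP[+ /existsP[e /and3P[ve ae ge]]] := gP _ vT.
  rewrite 2!inE => /andP[ga _].
  have /andP[_ /existsP[f /and3P[vf af gf]]] := gP _ vT'; rewrite -gE in gf.
  have GE h : a \in G h -> g v \in G h -> G h = [set a; g v].
    move=> ah gh; apply/esym/eqP; rewrite eqEcard subUset !sub1set ah gh.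
    by rewrite card_edge cards2 eq_sym ga.
  have ef : e = f.
    by apply: (@edge_inj _ _ G); rewrite (GE e ae ge) (GE f af gf).
  have := quad_disjoint v2 (etrans vd (esym vd')) nv ve.
  by rewrite ef => vf0; rewrite vf0 in vf.
have : (#|w |: nonreps_at S| <= 3)%N.
  have Sa : #|S :\ a| = 3%N by have := cardsD1 a S; rewrite S4 aS add1n => -[].
  rewrite -(card_in_imset g_inj) -[leqRHS]Sa.
  apply/subset_leq_card/subsetP => _ /imsetP[v vT ->].
  by have /andP[] := gP _ vT.
by rewrite cardsU1 wT.
Qed.

(** At the indicator of the edges of [u], [u] evaluates to 1 and its representative, edge-disjoint
    from it, to 0. *)
Lemma matching_point S (u : 'X_{1..m < 3}) : u \in nonreps_at S ->
  exists2 P, (forall e, P e != 0 -> G e \subset S)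
           & (rep_binomial K G u).@[P] != 0.
Proof.
move=> uS; have [uW S4 ud] := nonreps_atP uS.
have [u2 wd /nesym nu] := nonrepsP uW; have [w2 _] := fiber_repP G u2.
exists (fun e => (0 < u e)%N%:R) => [e|].
  by case: posnP => [|/(sub_edge_at uS erefl) //]; rewrite eqxx.
rewrite mevalB !mevalX big1 => [|e _]; last first.
  by case: posnP => [->|] //; rewrite expr1n.
set w := bmnm _ in w2 *.
have [e we] : exists e, (0 < w e)%N.
  have : mdeg w != 0%N by rewrite w2.
  rewrite mdegE sum_nat_eq0 negb_forall => /existsP[e] /=.
  by rewrite -lt0n; exists e.
have ue : u e = 0%N.
  by apply: (quad_disjoint w2 wd _ we); exact/nesym.
rewrite (bigD1 e) //= ue expr0n (gtn_eqF we) mul0r subr0; exact: oner_neq0.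
Qed.

(* On the plane used here, [c] being a vertex of [S], the monomials [u], [v] and
   their representative evaluate to [s], [t] and [0]. *)
Lemma plane_point S (u v : 'X_{1..m < 3}) F :
    u \in nonreps_at S -> v \in nonreps_at S -> u != v ->
    G_homogeneous G F -> gsupp G F = S ->
  exists P, [/\ forall e, P e != 0 -> G e \subset S, F.@[P] = 0
    & (rep_binomial K G u).@[P] != 0 \/ (rep_binomial K G v).@[P] != 0].
Proof.
move=> uS vS uv homF FS; have [uW S4 ud] := nonreps_atP uS.
have [vW _ vd] := nonreps_atP vS; have duv := nonreps_at_deg uS vS.
have [u2 wd nu] := nonrepsP uW; have [w2 _] := fiber_repP G u2.
have [v2 _ nv] := nonrepsP vW.
have nuv : bmnm u <> v by move=> /val_inj/eqP; apply/negP.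
have [c cS] : exists c, c \in S by apply/set0Pn; rewrite -card_gt0 S4.
(* Edges inside [S] away from [c] will get the value 1; at [c], the edge of [u] gets [s], that of
   [v] gets [t]; all other edges get 0. *)
pose p e : K :=
  ((G e \subset S) && ((c \in G e) ==> (0 < u e) || (0 < v e)))%N%:R.
pose a e : nat := (c \in G e) && (0 < u e)%N.
pose b e : nat := (c \in G e) && (u e == 0)%N.
(* [a e + b e] is the incidence of [c] with [e], so monomials of [F] have as weight the entry at [c]
   of their G-degree, positive as [c] lies in [S]. *)
have [||s [t [st FP]]] :=
  @whomog_nontrivial_zero K m F a b p (deg_G G (mlead F) c).
- by move: cS; rewrite -FS inE.
- move=> y yF; have F0 : F != 0 by apply: contraTneq yF => ->; rewrite msupp0.
  rewrite -(homF _ _ yF (mlead_supp F0)) deg_GE; apply: eq_bigr => e _.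
  by rewrite /a /b; case: (c \in G e) => //; case: (u e).
exists (fun e => p e * s ^+ a e * t ^+ b e); split=> // [e|].
  by rewrite /p; case: (G e \subset S) => //=; rewrite !mul0r eqxx.
have p1 (y : 'X_{1..m < 3}) : y \in nonreps_at S ->
    (forall e, 0 < y e -> (0 < u e) || (0 < v e))%N -> \prod_e p e ^+ y e = 1.
  move=> yS yuv; apply: big1 => e _; have [->|ye] := posnP (y e); first by [].
  by rewrite /p (sub_edge_at yS erefl ye) (yuv _ ye) implybT expr1n.
have wP : ('X_[fiber_rep G (deg_G G u)] : {mpoly K[m]}).@[
    fun e => p e * s ^+ a e * t ^+ b e] = 0.
  rewrite mevalX.
  have [|e ce we] := @edge_at_vertex _ _ G (fiber_rep G (deg_G G u)) c.
    by rewrite wd ud cS.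
  rewrite (bigD1 e) //= /p ce (quad_disjoint w2 wd nu we).
  have -> : v e = 0%N.
    by apply: (quad_disjoint w2 (etrans wd duv) _ we); rewrite duv.
  by rewrite andbF !mul0r expr0n (gtn_eqF we) mul0r.
rewrite /rep_binomial -duv !mevalB wP !subr0 !mevalX !prod_monomial_curve.
rewrite !p1 //; [|by move=> e ->; rewrite orbT|by move=> e ->].
have -> : (\sum_e a e * u e)%N = 1%N.
  transitivity (deg_G G u c); last by rewrite ud cS.
  rewrite deg_GE; apply: eq_bigr => e _; rewrite /a.
  by case: posnP => [->|]; rewrite ?muln0 // andbT.
have -> : (\sum_e b e * u e)%N = 0%N.
  by apply: big1 => e _; rewrite /b; case: eqP => [->|]; rewrite ?muln0 ?andbF.
have vu e : (0 < v e)%N -> u e = 0%N.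
  by apply: (quad_disjoint v2 (esym duv)) => /esym.
have -> : (\sum_e a e * v e)%N = 0%N.
  apply: big1 => e _; rewrite /a; have [->|/vu ->] := posnP (v e).
    by rewrite muln0.
  by rewrite andbF.
have -> : (\sum_e b e * v e)%N = 1%N.
  transitivity (deg_G G v c); last by rewrite vd cS.
  rewrite deg_GE; apply: eq_bigr => e _; rewrite /b.
  have [->|/vu ->] := posnP (v e).
    by rewrite !muln0.
  by rewrite eqxx andbT.
by rewrite !expr0 !expr1 !mul1r mulr1; apply/orP.
Qed.

Section Radical.
Variable L : seq {mpoly K[m]}.
Hypotheses (homL : forall f, f \in L -> G_homogeneous G f)
  (IL : forall f, f \in L -> toric_ideal K G f)
  (radL : forall p, toric_ideal K G p -> radical (list_ideal L) p).

(** Members of [L] over other vertex sets vanish at [P] by [meval_off_gsupp], so all of [L] does,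
    and with it the radical. *)
Lemma rep_binomial_meval0 S (u : 'X_{1..m < 3}) P : u \in nonreps_at S ->
    (forall e, P e != 0 -> G e \subset S) ->
    (forall f, f \in L -> gsupp G f = S -> f.@[P] = 0) ->
  (rep_binomial K G u).@[P] = 0.
Proof.
move=> uS PS fS; have [uW S4 _] := nonreps_atP uS.
apply: (@meval_radical _ _ L); last exact/radL/toric_rep_binomial.
move=> f fL; have [/(fS f fL) //|nS] := eqVneq (gsupp G f) S.
by apply: meval_off_gsupp nS; rewrite ?S4 //; [exact: homL | exact: IL].
Qed.

(** With no member of [L] over [S], [matching_point] excludes any nonrepresentative; with one,
    [plane_point] excludes two; two members suffice by [card_nonreps_at]. *)
Lemma leq_card_nonreps_at S :
  (#|nonreps_at S| <= count (fun f => gsupp G f == S) L)%N.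
Proof.
rewrite -size_filter; set L_S := filter _ L.
have inLS f : f \in L -> gsupp G f = S -> f \in L_S.
  by move=> fL /eqP fS; rewrite mem_filter fS.
have subL f : f \in L_S -> f \in L /\ gsupp G f = S.
  by rewrite mem_filter => /andP[/eqP].
case: L_S inLS subL => [|F [|F' L']] inLS subL /=.
- rewrite leqn0 cards_eq0; apply/eqP/setP => u; rewrite in_set0.
  apply/negP => uS; have [P PS] := matching_point uS.
  rewrite (rep_binomial_meval0 uS PS) ?eqxx // => f fL fS.
  by have := inLS f fL fS.
- rewrite leqNgt; apply/negP => /card_gt1P[u [v [uS vS uv]]].
  have [FL FS] := subL F (mem_head _ _).
  have [P [PS FP]] := plane_point uS vS uv (homL FL) FS.
  have FL0 f : f \in L -> gsupp G f = S -> f.@[P] = 0.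
    by move=> fL /(inLS f fL); rewrite inE => /eqP ->.
  by rewrite !(rep_binomial_meval0 _ PS FL0) // eqxx => -[].
- by rewrite (leq_trans (card_nonreps_at S)).
Qed.

(** Each member of [L] is counted at a single [S], so the bounds add up. *)
Lemma leq_card_nonreps_radical : (#|nonreps G| <= size L)%N.
Proof.
rewrite -sum1_card -sum1_size.
rewrite (partition_big (fun u : 'X_{1..m < 3} => vsupp (deg_G G u)) xpredT) //=.
rewrite [leqRHS](partition_big (gsupp G) xpredT) //=.
apply: leq_sum => S _; rewrite [leqRHS]sum1_count.
apply: leq_trans _ (leq_card_nonreps_at S).
rewrite -sum1_card; apply: eq_leq; apply: eq_bigl => u.
by rewrite [RHS]inE.
Qed.

End Radical.
End LowerBound.

Theorem theorem3p8 (K : closedFieldType) (n m : nat) (G : sgraph n m)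
    (hconn : connected G)
    (hquad : generated_by_quadratic_binomials (toric_ideal K G)) :
  (exists r : nat, is_bar (toric_ideal K G) r /\ is_mu (toric_ideal K G) r) /\
  (exists r : nat, is_ara_G G (toric_ideal K G) r /\ is_mu (toric_ideal K G) r).
Proof.
have gen := nonrep_binomials_gen hquad.
have mu : is_mu (toric_ideal K G) #|nonreps G|.
  split; first by exists (nonrep_binomials K G).
  by move=> t [F /leq_card_nonreps_gen].
have IB f : f \in nonrep_binomials K G -> is_binomial f /\ toric_ideal K G f.
  move=> /nonrep_binomialsP[u uW ->]; split; last exact: toric_rep_binomial.
  by exists u, (fiber_rep G (deg_G G u)).
(* The ideal is already radical, being the kernel of a map to a domain. *)
have radB : same_set (toric_ideal K G)
    (radical (list_ideal (nonrep_binomials K G))).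
  move=> p; split=> [Ip|[k [k0 /gen Ipk]]]; last first.
    by apply: toric_radical; exists k.
  by exists 1%N; split=> //; rewrite expr1; apply/gen.
split; exists #|nonreps G|; split=> //; split.
- by exists (nonrep_binomials K G); split=> // f /IB[].
- move=> t [F [binF IF radF]]; rewrite -(size_tuple F).
  apply: leq_card_nonreps_radical => // [f fF | p /radF //].
  by apply: toric_binomial_homogeneous; [exact: binF | exact: IF].
- exists (nonrep_binomials K G); split=> // f /IB[] //.
  exact: toric_binomial_homogeneous.
- move=> t [F [homF IF radF]]; rewrite -(size_tuple F).
  by apply: leq_card_nonreps_radical => // p /radF.
Qed.
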